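(* Let $\mathcal{D}$ be a finite structure with domain $D$ and let $U,X\subseteq D$ be sets selected as in the definition of a $U$-$X$-core of $\mathcal{D}$, and assume $U\cup X=D$. Then every surjective hyper-endomorphism of $\mathcal{D}$ is in the 3-permuted form with respect to $U,X$. Moreover, every surjective hyper-endomorphism $f$ of $\mathcal{D}$ that is $U$-surjective and $X$-total additionally satisfies $f(U\setminus X)\cap X=\bigcup_{u\in U\setminus X}X_u=X\setminus U$, where the sets $X_u$ are those of its 3-permuted form.
   Context: Structures are finite relational structures with nonempty domain. A shop of $D$ is a map $f$ from $D$ to the power set of $D$ with $f(d)\neq\emptyset$ for all $d$ and $\bigcup_d f(d)=D$; it is a surjective hyper-endomorphism of $\mathcal{D}$ if for each relation $R$ of arity $i$, $R(a_1,\dots,a_i)$ in $\mathcal{D}$ implies $R(b_1,\dots,b_i)$ in $\mathcal{D}$ for all $b_j\in f(a_j)$. $f(S)=\bigcup_{s\in S}f(s)$; $f$ is $U$-surjective if $f(U)=D$ and $X$-total if $f(d)\cap X\neq\emptyset$ for all $d$. Selection of $U,X$ for a $U$-$X$-core: $U$ has minimum cardinality among subsets $U'$ for which a $U'$-surjective surjective hyper-endomorphism exists, $X$ has minimum cardinality among subsets $X'$ for which an $X'$-total surjective hyper-endomorphism exists, and among such choices $|U\cap X|$ is maximum. A shop $f$ is in the 3-permuted form (w.r.t. $U,X$) if there are a permutation $\zeta$ of $X\cap U$, a permutation $\chi$ of $X\setminus U$ and a permutation $\upsilon$ of $U\setminus X$ such that $f(y)=\{\zeta(y)\}$ for $y\in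 U\cap X$, $f(x)=\{\chi(x)\}$ for $x\in X\setminus U$, and $f(u)=\{\upsilon(u)\}\cup X_u$ with $X_u\subseteq X\setminus U$ for $u\in U\setminus X$. *)

(* Defs.v *)
From mathcomp Require Import all_boot all_fingroup.

Set Implicit Arguments.
Unset Strict Implicit.
Unset Printing Implicit Defensive.

(* Only the domain is required to be finite: the set of relation symbols is
   arbitrary. *)
Record signature := Signature { symbol : Type; arity : symbol -> nat }.

Record structure (sg : signature) := Structure {
  dom :> finType;
  dom_nonempty : 0 < #|dom|;
  interp : forall R : symbol sg, {set (arity R).-tuple dom} }.

Section Shops.
Variable T : finType.
Implicit Types (f : T -> {set T}) (U X S : {set T}).

Definition img f S : {set T} := \bigcup_(s in S) f s.

Definition is_shop f : Prop :=
  (forall d, f d != set0) /\ \bigcup_d f d = [set: T].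

Definition surjective_from U f : Prop := img f U = [set: T].

Definition total_on X f : Prop := forall d, f d :&: X != set0.

(* A permutation of a subset S of T is a permutation of T fixing every point
   outside S (perm_on S). Only the values of Xs on U :\: X are relevant. *)
Definition three_permuted_by U X (zeta chi upsilon : {perm T})
    (Xs : T -> {set T}) f : Prop :=
  [/\ [/\ perm_on (X :&: U) zeta, perm_on (X :\: U) chi
        & perm_on (U :\: X) upsilon],
      forall y, y \in U :&: X -> f y = [set zeta y],
      forall x, x \in X :\: U -> f x = [set chi x]
    & forall u, u \in U :\: X ->
        Xs u \subset X :\: U /\ f u = [set upsilon u] :|: Xs u].

Definition three_permuted U X f : Prop :=
  exists (zeta chi upsilon : {perm T}) (Xs : T -> {set T}),
    three_permuted_by U X zeta chi upsilon Xs f.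

Definition min_card (P : {set T} -> Prop) S : Prop :=
  P S /\ forall S', P S' -> #|S| <= #|S'|.

End Shops.

Section HyperEndomorphisms.
Variables (sg : signature) (D : structure sg).

Definition surj_hyper_endo (f : D -> {set D}) : Prop :=
  is_shop f /\
  forall (R : symbol sg) (a b : (arity R).-tuple D),
    a \in interp D R -> (forall j, tnth b j \in f (tnth a j)) ->
    b \in interp D R.

Definition min_surjective_set : {set D} -> Prop :=
  min_card (fun U => exists2 f, surj_hyper_endo f & surjective_from U f).

Definition min_total_set : {set D} -> Prop :=
  min_card (fun X => exists2 f, surj_hyper_endo f & total_on X f).

(* #|U :&: X| is maximised over all pairs of minimum sets, both components
   being free to vary. *)
Definition UX_selection (U X : {set D}) : Prop :=
  [/\ min_surjective_set U, min_total_set X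
    & forall U' X' : {set D}, min_surjective_set U' -> min_total_set X' ->
        #|U' :&: X'| <= #|U :&: X|].

End HyperEndomorphisms.

(* Main.v *)
(** Surjective hyper-endomorphisms are closed under composition. If [f] is
    [U]-surjective, minimality of [U], applied to [f o f], forces [f] to induce
    a permutation of [U]; dually, an [X]-total one induces a permutation of [X].
    A suitable power [p] of a composite that is both [U]-surjective and
    [X]-total then satisfies [d \in p d] for all [d], because [U :|: X] is
    everything. Any [f] is therefore contained in [F = p o f o p], which is
    again [U]-surjective and [X]-total, hence permutes [U] and [X]. If [f]
    mapped some [x] of [X] to some [v] of [U :\: X], replacing the image of [x]
    by [v] in [X] would enlarge the intersection with [U]; so [f] maps [X] into
    [X], and the permuted form follows. *)

Require Import Defs.
From mathcomp Require Import all_boot all_fingroup.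

Set Implicit Arguments.
Unset Strict Implicit.
Unset Printing Implicit Defensive.

(** * Composition and converse of hyper-operations *)

Section HyperOperations.
Variable T : finType.
Implicit Types (f g : T -> {set T}) (S U X : {set T}).

Definition hcomp f g : T -> {set T} := fun d => img f (g d).

Definition hconv f : T -> {set T} := fun d => [set e | d \in f e].

Lemma imgP f S d : reflect (exists2 s, s \in S & d \in f s) (d \in img f S).
Proof. exact: bigcupP. Qed.

Lemma mem_hcomp f g d c e : c \in g d -> e \in f c -> e \in hcomp f g d.
Proof. by move=> cgd efc; apply/imgP; exists c. Qed.

Lemma img_hcomp f g S : img (hcomp f g) S = img f (img g S).
Proof.
apply/setP=> d; apply/imgP/imgP=> [[s sS /imgP[c cg df]]|[c /imgP[s sS cg] df]].
  by exists c => //; apply/imgP; exists s.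
by exists s => //; apply/imgP; exists c.
Qed.

Lemma is_shopT f : is_shop f -> img f [set: T] = [set: T].
Proof. by case=> _ fT; rewrite -[RHS]fT; apply: eq_bigl => d; rewrite inE. Qed.

Lemma is_shop_cover f : is_shop f -> forall d, exists c, d \in f c.
Proof.
move=> /is_shopT fT d; have /imgP[c _ dfc] : d \in img f setT by rewrite fT.
by exists c.
Qed.

Lemma is_shop_hcomp f g : is_shop f -> is_shop g -> is_shop (hcomp f g).
Proof.
move=> sf sg; split=> [d|].
  have [c cg] := set0Pn _ (sg.1 d); have [e ef] := set0Pn _ (sf.1 c).
  by apply/set0Pn; exists e; apply: mem_hcomp cg ef.
apply/setP=> d; rewrite inE; have [c df] := is_shop_cover sf d.
have [e cg] := is_shop_cover sg c.
by apply/bigcupP; exists e => //; apply: mem_hcomp cg df.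
Qed.

Lemma surjective_from_hcomp U f g :
  is_shop f -> surjective_from U g -> surjective_from U (hcomp f g).
Proof. by move=> sf gU; rewrite /surjective_from img_hcomp gU is_shopT. Qed.

Lemma total_on_hcomp X f g : is_shop g -> total_on X f -> total_on X (hcomp f g).
Proof.
move=> [gn0 _] fX d; have [c cg] := set0Pn _ (gn0 d).
have [e] := set0Pn _ (fX c); rewrite inE => /andP[ef eX].
by apply/set0Pn; exists e; rewrite inE eX (mem_hcomp cg ef).
Qed.

Lemma total_on_hconv X f : total_on X f <-> surjective_from X (hconv f).
Proof.
split=> [fX|fX d].
  apply/setP=> d; rewrite inE; have [x] := set0Pn _ (fX d).
  by rewrite inE => /andP[xf xX]; apply/imgP; exists x; rewrite ?inE.
have /imgP[x xX] : d \in img (hconv f) X by rewrite fX.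
by rewrite inE => xf; apply/set0Pn; exists x; rewrite inE xf.
Qed.

Lemma hconv_hcomp f g d : hconv (hcomp f g) d = hcomp (hconv g) (hconv f) d.
Proof.
apply/setP=> e; rewrite inE; apply/imgP/imgP=> -[c].
  by move=> cg df; exists c; rewrite inE.
by rewrite !inE => df cg; exists c.
Qed.

(** * Permutations induced on subsets, and the permuted form *)

Lemma perm_on_extend S (a : T -> T) :
    (forall u, u \in S -> a u \in S) -> {in S &, injective a} ->
  exists2 s : {perm T}, perm_on S s & {in S, s =1 a}.
Proof.
move=> aS injaS; pose b d := if d \in S then a d else d.
have injb : injective b.
  move=> c d; rewrite /b; case: ifPn => cS; case: ifPn => dS //.
  - exact: injaS.
  - by move=> e; rewrite -e aS in dS.
  - by move=> e; rewrite e aS in cS.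
exists (perm injb) => [|d dS]; last by rewrite permE /b dS.
by apply/subsetP=> d; rewrite inE permE /b; case: ifP => //; rewrite eqxx.
Qed.

Lemma perm_restr S (s : {perm T}) :
    (forall u, u \in S -> s u \in S) ->
  exists2 t : {perm T}, perm_on S t & {in S, t =1 s}.
Proof. by move=> sS; apply: perm_on_extend => // x y _ _; apply: perm_inj. Qed.

Lemma surjective_from_perm S f :
    surjective_from S f ->
    (forall S', surjective_from S' (hcomp f f) -> #|S| <= #|S'|) ->
  exists2 s : {perm T}, perm_on S s &
    {in S &, forall u v, (v \in f u) = (v == s u)}.
Proof.
move=> fS minS.
(* If [a] chooses preimages inside [S], then [f o f] is already surjective from [a @: S]: each [d]
   lies in [f u] for some [u] in [S], and [u] lies in [f (a u)]. Minimality then forbids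
   collisions. *)
have injS (a : T -> T) :
  (forall u, u \in S -> a u \in S /\ u \in f (a u)) -> {in S &, injective a}.
  move=> aS; apply/imset_injP; rewrite eqn_leq leq_imset_card minS //.
  rewrite /surjective_from img_hcomp; apply/setP=> d; rewrite inE.
  have /imgP[u uS du] : d \in img f S by rewrite fS.
  apply/imgP; exists u => //; apply/imgP; exists (a u).
    exact: imset_f.
  by case: (aS u uS).
have [a aP] : exists a : T -> T, forall u, u \in S -> a u \in S /\ u \in f (a u).
  apply: (fin_all_exists (P := fun u v => u \in S -> v \in S /\ u \in f v)) => u.
  have /imgP[v vS uv] : u \in img f S by rewrite fS.
  by exists v.
have [s sS sa] := perm_on_extend (fun u uS => (aP u uS).1) (injS a aP).
(* [s] selects preimages, so the action of [f] on [S] is its inverse. *)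
exists s^-1%g => [|w v wS vS]; first exact: perm_onV.
rewrite -(inj_eq (@perm_inj _ s)) permKV.
apply/idP/eqP=> [vw|<-]; last by rewrite sa //; case: (aP v vS).
(* Redirecting the choice at [v] to [w] must again give an injective map. *)
pose b u := if u == v then w else a u.
have injb : {in S &, injective b}.
  by apply: injS => u uS; rewrite /b; case: eqP => [->|_]; [split|apply: aP].
have v'S : s^-1%g w \in S by rewrite (perm_closed w (perm_onV sS)).
have aw : a (s^-1%g w) = w by rewrite -sa // permKV.
(* Both [v] and the point that [a] sends to [w] have value [w] under [b]. *)
suff <- : s^-1%g w = v by rewrite permKV.
by apply: injb => //; rewrite /b eqxx; case: eqP.
Qed.

(** Dual of the previous lemma through [hconv]. Converse reverses the order of composition, which is
    harmless for [f o f], and inverts the permutation. *)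
Lemma total_on_perm S f :
    total_on S f ->
    (forall S', total_on S' (hcomp f f) -> #|S| <= #|S'|) ->
  exists2 s : {perm T}, perm_on S s &
    {in S &, forall u v, (v \in f u) = (v == s u)}.
Proof.
move=> /total_on_hconv fS minS.
have [S' S'f|s sS sP] := surjective_from_perm fS.
  apply/minS/total_on_hconv; rewrite /surjective_from -S'f.
  by apply: eq_bigr => d _; apply: hconv_hcomp.
exists s^-1%g => [|u v uS vS]; first exact: perm_onV.
have := sP v u vS uS; rewrite inE => ->.
by rewrite -(inj_eq (@perm_inj _ s) v) permKV eq_sym.
Qed.

(** The iteration starts at [f], not at the identity, so it is the composite of [k.+1] copies. *)
Lemma iter_hcomp_perm S f (s : {perm T}) k :
    perm_on S s -> {in S &, forall u v, (v \in f u) = (v == s u)} ->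
  {in S, forall u, (s ^+ k.+1)%g u \in iter k (hcomp f) f u}.
Proof.
move=> sS sP u uS; elim: k => [|k IH] /=.
  by rewrite expg1 sP // (perm_closed u sS).
apply: mem_hcomp IH _; rewrite expgSr permM.
have kS : (s ^+ k.+1)%g u \in S.
  elim: k.+1 => [|m mS]; first by rewrite expg0 perm1.
  by rewrite expgSr permM (perm_closed _ sS).
by rewrite sP // (perm_closed _ sS).
Qed.

(** Intersecting [f u] with [X] drops only [upsilon u]. A point of [X :\: U] must be reached from
    [U], but not from [U :&: X], where all values stay in [U]. *)
Lemma three_permuted_by_cover U X (zeta chi upsilon : {perm T}) Xs f :
    three_permuted_by U X zeta chi upsilon Xs f -> surjective_from U f ->
  img f (U :\: X) :&: X = \bigcup_(u in U :\: X) Xs u /\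
  \bigcup_(u in U :\: X) Xs u = X :\: U.
Proof.
move=> [[zetaP _ upsP] fz _ fu] fU.
have eqXs u : u \in U :\: X -> f u :&: X = Xs u.
  move=> uUX; have [XsX ->] := fu u uUX; rewrite setIUl.
  have /setDP[_ uX] : upsilon u \in U :\: X by rewrite perm_closed.
  rewrite (_ : [set upsilon u] :&: X = set0); last first.
    by apply/setP=> d; rewrite !inE; case: eqP => //= ->; apply/negbTE.
  by rewrite set0U; apply/setIidPl/(subset_trans XsX)/subsetDl.
have imgXs : img f (U :\: X) :&: X = \bigcup_(u in U :\: X) Xs u.
  by rewrite /img big_distrl /=; apply: eq_bigr.
split=> //; apply/eqP; rewrite eqEsubset; apply/andP; split.
  by apply/bigcupsP=> u /fu[].
apply/subsetP=> x /setDP[xX xU].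
have /imgP[u uU xf] : x \in img f U by rewrite fU.
have uX : u \notin X.
  apply: contra xU => uX; move: xf; rewrite fz ?inE ?uU // => /eqP->.
  by have /setIP[] : zeta u \in X :&: U by rewrite perm_closed // inE uX.
have uUX : u \in U :\: X by rewrite inE uX.
by apply/bigcupP; exists u => //; rewrite -eqXs // inE xf.
Qed.

End HyperOperations.

(** * Consequences of the minimality and maximality of [U] and [X] *)

Section Selection.
Variables (sg : signature) (D : structure sg).
Implicit Types (f g : D -> {set D}) (U X : {set D}).

Lemma she_hcomp f g :
  surj_hyper_endo f -> surj_hyper_endo g -> surj_hyper_endo (hcomp f g).
Proof.
move=> [sf hf] [sg' hg]; split; first exact: is_shop_hcomp.
move=> R a b aR ab.
have /fin_all_exists[c cP] : forall j, exists c,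
    c \in g (tnth a j) /\ tnth b j \in f c.
  by move=> j; have /imgP[c] := ab j; exists c.
apply: (hf R [tuple c j | j < arity R]) => [|j]; last first.
  by rewrite tnth_mktuple; case: (cP j).
by apply: hg aR _ => j; rewrite tnth_mktuple; case: (cP j).
Qed.

Lemma she_iter_hcomp f k :
  surj_hyper_endo f -> surj_hyper_endo (iter k (hcomp f) f).
Proof. by move=> hf; elim: k => //= k; apply: she_hcomp. Qed.

Lemma she_surjective_perm U f :
    min_surjective_set U -> surj_hyper_endo f -> surjective_from U f ->
  exists2 s : {perm D}, perm_on U s &
    {in U &, forall u v, (v \in f u) = (v == s u)}.
Proof.
move=> [_ minU] hf fU; apply: surjective_from_perm => // S fS.
by apply: minU; exists (hcomp f f); first exact: she_hcomp.
Qed.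

Lemma she_total_perm X f :
    min_total_set X -> surj_hyper_endo f -> total_on X f ->
  exists2 s : {perm D}, perm_on X s &
    {in X &, forall u v, (v \in f u) = (v == s u)}.
Proof.
move=> [_ minX] hf fX; apply: total_on_perm => // S fS.
by apply: minX; exists (hcomp f f); first exact: she_hcomp.
Qed.

Lemma she_extensive U X :
    min_surjective_set U -> min_total_set X -> U :|: X = [set: D] ->
  exists p, [/\ surj_hyper_endo p, surjective_from U p, total_on X p
              & forall d, d \in p d].
Proof.
move=> mU mX hUX; have [[g hg gU] _] := mU; have [[h hh hX] _] := mX.
pose f := hcomp h g.
have hf : surj_hyper_endo f by apply: she_hcomp.
have fU : surjective_from U f by apply: surjective_from_hcomp => //; case: hh.
have fX : total_on X f by apply: total_on_hcomp => //; case: hg.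
have [s sU sP] := she_surjective_perm mU hf fU.
have [t tX tP] := she_total_perm mX hf fX.
(* The exponent [k.+1] is a common multiple of both orders, so the composite fixes [U] and [X]
   pointwise in the sense of membership. *)
pose k := (#[s]%g * #[t]%g).-1.
have k1 : k.+1 = #[s]%g * #[t]%g by rewrite prednK // muln_gt0 !order_gt0.
exists (iter k (hcomp f) f); split=> [|||d].
- exact: she_iter_hcomp.
- by elim: k {k1} => //= k; apply: surjective_from_hcomp; case: hf.
- case: {k1} k => //= k; apply: total_on_hcomp => //.
  by case: (she_iter_hcomp k hf).
have : d \in U :|: X by rewrite hUX.
case/setUP=> [dU|dX].
  have := iter_hcomp_perm k sU sP dU.
  by rewrite k1 expgM expg_order expg1n perm1.
have := iter_hcomp_perm k tX tP dX.
by rewrite k1 mulnC expgM expg_order expg1n perm1.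
Qed.

Lemma she_enlarge U X f :
    min_surjective_set U -> min_total_set X -> U :|: X = [set: D] ->
    surj_hyper_endo f ->
  exists F, [/\ surj_hyper_endo F, surjective_from U F, total_on X F
              & forall d, f d \subset F d].
Proof.
move=> mU mX hUX hf; have [p [hp pU pX pd]] := she_extensive mU mX hUX.
have hfp := she_hcomp hf hp.
(* The inner [p] provides [U]-surjectivity and the outer one [X]-totality. *)
exists (hcomp p (hcomp f p)); split.
- exact: she_hcomp.
- by apply: surjective_from_hcomp; [case: hp|apply: surjective_from_hcomp; case: hf].
- by apply: total_on_hcomp => //; case: hfp.
move=> d; apply/subsetP=> e ef.
exact: mem_hcomp (mem_hcomp (pd d) ef) (pd e).
Qed.

Lemma she_preserves_X U X f :
    UX_selection U X -> U :|: X = [set: D] -> surj_hyper_endo f ->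
  forall x, x \in X -> f x \subset X.
Proof.
move=> [mU mX maxUX] hUX hf x xX; apply/subsetP=> v vf; apply/negPn/negP=> vX.
have vU : v \in U by have := in_setT v; rewrite -hUX inE (negbTE vX) orbF.
have [p [hp pU pX pd]] := she_extensive mU mX hUX.
pose F := hcomp p f.
have hF : surj_hyper_endo F by apply: she_hcomp.
have FX : total_on X F by apply: total_on_hcomp => //; case: hf.
have vF : v \in F x by apply: mem_hcomp vf (pd v).
have [s _ sP] := she_surjective_perm mU hp pU.
have [t tX tP] := she_total_perm mX hF FX.
(* A point [y] of [p v] in [X] lies in [F x], hence equals [t x]. Were it in [U], both [v] and [y]
   would be the only point of [U] in [p v], putting [v] in [X]. *)
have txU : t x \notin U.
  have [y] := set0Pn _ (pX v); rewrite inE => /andP[ypv yX].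
  have := mem_hcomp vf ypv; rewrite -/F tP // => /eqP <-.
  apply/negP=> yU; move: ypv; rewrite sP // => /eqP ysv.
  by move: (pd v); rewrite sP // -ysv => /eqP vy; rewrite vy yX in vX.
have txX : t x \in X by rewrite (perm_closed x tX).
pose X' := v |: X :\ t x.
have cardX' : #|X'| = #|X|.
  by rewrite cardsU1 !inE (negbTE vX) andbF (cardsD1 (t x) X) txX.
have mX' : min_total_set X'.
  case: mX => _ minX; split=> [|S' S'P]; last by rewrite cardX'; apply: minX.
  (* Go from [d] to some [w] of [X] by [p], then to [v] if [w] is [x], and otherwise to [t w], which
     differs from the removed [t x]. *)
  exists (hcomp F p) => [|d]; first exact: she_hcomp.
  have [w] := set0Pn _ (pX d); rewrite inE => /andP[wp wX]; apply/set0Pn.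
  have [wx|wx] := eqVneq w x.
    by exists v; rewrite inE setU11 andbT; apply: mem_hcomp wp _; rewrite wx.
  have twX : t w \in X by rewrite (perm_closed w tX).
  exists (t w); rewrite !inE (inj_eq perm_inj) wx twX orbT andbT.
  by apply: mem_hcomp wp _; rewrite tP.
have := maxUX U X' mU mX'.
rewrite (_ : U :&: X' = v |: (U :&: X)) ?cardsU1 ?inE ?(negbTE vX) ?andbF ?ltnn //.
apply/setP=> d; rewrite !inE; have [->|_] := eqVneq d v; first by rewrite vU.
by have [->|_] := eqVneq d (t x); rewrite //= (negbTE txU).
Qed.

Lemma she_three_permuted U X f :
    UX_selection U X -> U :|: X = [set: D] -> surj_hyper_endo f ->
  three_permuted U X f.
Proof.
move=> hsel hUX hf; have [mU mX _] := hsel.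
have [F [hF FU FX fF]] := she_enlarge mU mX hUX hf.
have [s sU sP] := she_surjective_perm mU hF FU.
have [t tX tP] := she_total_perm mX hF FX.
have fX := she_preserves_X hsel hUX hf.
have ft x : x \in X -> f x = [set t x].
  move=> xX; have [y yf] := set0Pn _ (hf.1.1 x); apply/eqP.
  rewrite eqEsubset; have sub : f x \subset [set t x].
    apply/subsetP=> z zf; have zX := subsetP (fX x xX) z zf.
    by rewrite inE -tP // (subsetP (fF x)).
  by rewrite sub sub1set; have := subsetP sub y yf; rewrite inE => /eqP <-.
(* [F] also preserves [X], so [s z] is a point of [X] in [F z], and [t z] is the only one. *)
have stUX z : z \in X :&: U -> s z = t z.
  case/setIP=> zX zU; have sF : s z \in F z by rewrite sP // (perm_closed z sU).
  have szX := subsetP (she_preserves_X hsel hUX hF zX) _ sF.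
  by apply/eqP; rewrite -tP.
have tXU z : z \in X :&: U -> t z \in X :&: U.
  move=> zXU; case/setIP: (zXU) => zX zU.
  by rewrite inE -{2}stUX // (perm_closed z tX) zX (perm_closed z sU).
(* By finiteness [r] maps [X :&: U] onto itself, so no outside point enters it; hence [t] preserves
   [X :\: U] and [s] preserves [U :\: X]. *)
have invXU (r : {perm D}) : (forall z, z \in X :&: U -> r z \in X :&: U) ->
    forall d, r d \in X :&: U -> d \in X :&: U.
  move=> rXU d rd; have [q qS qr] := perm_restr rXU.
  have qd : q^-1%g (r d) \in X :&: U by rewrite (perm_closed _ (perm_onV qS)).
  suff <- : q^-1%g (r d) = d by [].
  by apply: (@perm_inj _ r); rewrite -qr // permKV.
have [zeta zetaP zetaE] := perm_restr tXU.
have [chi chiP chiE] : exists2 r : {perm D}, perm_on (X :\: U) r &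
    {in X :\: U, r =1 t}.
  apply: perm_restr => x /setDP[xX xU].
  rewrite inE (perm_closed x tX) xX andbT; apply: contra xU => txU.
  have /invXU/setIP[] // : t x \in X :&: U by rewrite inE (perm_closed x tX) xX.
have [ups upsP upsE] : exists2 r : {perm D}, perm_on (U :\: X) r &
    {in U :\: X, r =1 s}.
  apply: perm_restr => u /setDP[uU uX].
  rewrite inE (perm_closed u sU) uU andbT; apply: contra uX => suX.
  have /invXU/setIP[] // : s u \in X :&: U by rewrite inE (perm_closed u sU) uU suX.
  by move=> z zXU; rewrite stUX // tXU.
exists zeta, chi, ups, (fun u => f u :\: U); split=> [|y yUX|x xXU|u uUX] //.
- by move: yUX; rewrite setIC => yXU; rewrite zetaE // ft //; case/setIP: yXU.
- by rewrite chiE // ft //; case/setDP: xXU.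
have /setDP[uU uX] := uUX.
have fs d e : d \in U -> e \in U -> e \in f d -> e = s d.
  by move=> dU eU ef; apply/eqP; rewrite -sP // (subsetP (fF d)).
have suUX : s u \in U :\: X by rewrite -upsE // perm_closed.
have /setDP[suU suX] := suUX.
split.
  apply/subsetP=> d; rewrite !inE => /andP[dU _]; rewrite dU /=.
  by have := in_setT d; rewrite -hUX inE (negbTE dU).
(* Containment in [F] only bounds [f u] from above. Some [d] has [s u] in [f d]; it is outside [X],
   which [f] preserves, so it is in [U], and injectivity of [s] gives [d = u]. *)
have suf : s u \in f u.
  have [d df] := is_shop_cover hf.1 (s u).
  have dX : d \notin X by apply: contra suX => dX; apply: (subsetP (fX d dX)).
  have dU : d \in U by have := in_setT d; rewrite -hUX inE (negbTE dX) orbF.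
  by have /perm_inj ud := fs d (s u) dU suU df; rewrite {2}ud.
rewrite upsE //; apply/setP=> d; rewrite !inE.
have [->|dsu] := eqVneq d (s u); first by rewrite suf.
case dU : (d \in U) => //=; apply/negbTE; apply: contra dsu => df.
by apply/eqP/fs.
Qed.

End Selection.

Theorem theorem12 (sg : signature) (D : structure sg) (U X : {set D})
    (hsel : UX_selection U X) (hUX : U :|: X = [set: D]) :
  (forall f : D -> {set D}, surj_hyper_endo f -> three_permuted U X f) /\
  (forall f : D -> {set D}, surj_hyper_endo f ->
     surjective_from U f -> total_on X f ->
     forall (zeta chi upsilon : {perm D}) (Xs : D -> {set D}),
       three_permuted_by U X zeta chi upsilon Xs f ->
       img f (U :\: X) :&: X = \bigcup_(u in U :\: X) Xs u /\
       \bigcup_(u in U :\: X) Xs u = X :\: U).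
Proof.
split=> [f hf|f _ fU _ zeta chi upsilon Xs fP].
  exact: she_three_permuted.
exact: three_permuted_by_cover fP fU.
Qed.
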